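(* Let $\beta\ge 1$ be a real number. With the polynomials $\tilde A_k^\beta,\tilde C_k^\beta,\tilde D_k^\beta\in\mathbb{R}[\zeta]$ ($k=2,3,4$) defined in the context, the following hold. (i) For $k=2,3,4$, $\gcd\big(\tilde A_k^\beta(\zeta),\zeta\tilde C_k^\beta(\zeta)\big)=\gcd\big(\tilde D_k^\beta(\zeta),\tilde C_k^\beta(\zeta)\big)=1$, i.e. each of these pairs has no (nonconstant) common divisor. (ii) For $k=2,3,4$, $$\operatorname{Re}\frac{\tilde A_k^\beta(\zeta)}{\zeta\,\tilde C_k^\beta(\zeta)}>0\quad\text{for all }\zeta\in\mathbb{C}\text{ with }|\zeta|>1 .$$ (iii) For $k=2,3$, $$\operatorname{Re}\frac{\tilde D_k^\beta(\zeta)}{\tilde C_k^\beta(\zeta)}>0\quad\text{for all }\zeta\in\mathbb{C}\text{ with }|\zeta|>1 .$$ (iv) If moreover $\beta\ge 2$, then $$\operatorname{Re}\frac{\tilde D_4^\beta(\zeta)}{\tilde C_4^\beta(\zeta)}>0\quad\text{for all }\zeta\in\mathbb{C}\text{ with }|\zeta|>1 .$$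
   Context: For $k=2,3,4$ put $\tilde A_k^\beta(\zeta)=\sum_{q=0}^{k}a_{k,q}(\beta)\zeta^q$, $\tilde C_k^\beta(\zeta)=\sum_{q=0}^{k-1}c_{k,q}(\beta)\zeta^q$, $\tilde D_k^\beta(\zeta)=\sum_{q=0}^{k-1}d_{k,q}(\beta)\zeta^q$, with the following coefficients. $k=2$: $a_{2,2}=\frac{2\beta+1}{2}$, $a_{2,1}=-2\beta$, $a_{2,0}=\frac{2\beta-1}{2}$; $c_{2,1}=\beta+1$, $c_{2,0}=-\beta$; $d_{2,1}=\frac1\beta$, $d_{2,0}=0$. $k=3$: $a_{3,3}=\frac{3\beta^2+6\beta+2}{6}$, $a_{3,2}=-\frac{9\beta^2+12\beta-3}{6}$, $a_{3,1}=\frac{9\beta^2+6\beta-6}{6}$, $a_{3,0}=-\frac{3\beta^2-1}{6}$; $c_{3,2}=\frac{\beta^2+3\beta+2}{2}$, $c_{3,1}=-(\beta^2+2\beta)$, $c_{3,0}=\frac{\beta^2+\beta}{2}$; $d_{3,2}=1$, $d_{3,1}=\frac{1-\beta}{1+\beta}$, $d_{3,0}=0$. $k=4$: $a_{4,4}=\frac{2\beta^3+9\beta^2+11\beta+3}{12}$, $a_{4,3}=\frac{-8\beta^3-30\beta^2-20\beta+10}{12}$, $a_{4,2}=\frac{12\beta^3+36\beta^2+6\beta-18}{12}$, $a_{4,1}=\frac{-8\beta^3-18\beta^2+4\beta+6}{12}$, $a_{4,0}=\frac{2\beta^3+3\beta^2-\beta-1}{12}$; $c_{4,3}=\frac{\beta^3+6\beta^2+11\beta+6}{6}$,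 $c_{4,2}=\frac{-\beta^3-5\beta^2-6\beta}{2}$, $c_{4,1}=\frac{\beta^3+4\beta^2+3\beta}{2}$, $c_{4,0}=\frac{-\beta^3-3\beta^2-2\beta}{6}$; $d_{4,3}=\frac{\beta^2}{6}+\frac{\beta}{2}+\frac13$, $d_{4,2}=-\big(\frac{\beta^2}{2}+\frac{\beta}{2}-1\big)$, $d_{4,1}=\frac{\beta(\beta-1)}{2}$, $d_{4,0}=-\frac{\beta(\beta^2-1)}{6(\beta+3)}$. *)

(* Defs.v *)
From HB Require Import structures.
From mathcomp Require Export all_boot all_order all_algebra.
From mathcomp Require Export complex.
From mathcomp Require Export reals.

Set Implicit Arguments.
Unset Strict Implicit.
Unset Printing Implicit Defensive.

Import Order.TTheory GRing.Theory Num.Theory.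
Local Open Scope ring_scope.

(* Coefficients are listed by increasing degree; only k = 2, 3, 4 is
   meaningful. *)
Definition a_coefs (R : realType) (k : nat) (b : R) : seq R :=
  match k with
  | 2 => [:: (2 * b - 1) / 2;
             - (2 * b);
             (2 * b + 1) / 2]
  | 3 => [:: - ((3 * b ^+ 2 - 1) / 6);
             (9 * b ^+ 2 + 6 * b - 6) / 6;
             - ((9 * b ^+ 2 + 12 * b - 3) / 6);
             (3 * b ^+ 2 + 6 * b + 2) / 6]
  | 4 => [:: (2 * b ^+ 3 + 3 * b ^+ 2 - b - 1) / 12;
             (- 8 * b ^+ 3 - 18 * b ^+ 2 + 4 * b + 6) / 12;
             (12 * b ^+ 3 + 36 * b ^+ 2 + 6 * b - 18) / 12;
             (- 8 * b ^+ 3 - 30 * b ^+ 2 - 20 * b + 10) / 12;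
             (2 * b ^+ 3 + 9 * b ^+ 2 + 11 * b + 3) / 12]
  | _ => [::]
  end.

Definition c_coefs (R : realType) (k : nat) (b : R) : seq R :=
  match k with
  | 2 => [:: - b;
             b + 1]
  | 3 => [:: (b ^+ 2 + b) / 2;
             - (b ^+ 2 + 2 * b);
             (b ^+ 2 + 3 * b + 2) / 2]
  | 4 => [:: (- b ^+ 3 - 3 * b ^+ 2 - 2 * b) / 6;
             (b ^+ 3 + 4 * b ^+ 2 + 3 * b) / 2;
             (- b ^+ 3 - 5 * b ^+ 2 - 6 * b) / 2;
             (b ^+ 3 + 6 * b ^+ 2 + 11 * b + 6) / 6]
  | _ => [::]
  end.

Definition d_coefs (R : realType) (k : nat) (b : R) : seq R :=
  match k with
  | 2 => [:: 0;
             1 / b]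
  | 3 => [:: 0;
             (1 - b) / (1 + b);
             1]
  | 4 => [:: - (b * (b ^+ 2 - 1) / (6 * (b + 3)));
             b * (b - 1) / 2;
             - (b ^+ 2 / 2 + b / 2 - 1);
             b ^+ 2 / 6 + b / 2 + 1 / 3]
  | _ => [::]
  end.

Definition tildeA (R : realType) (k : nat) (b : R) : {poly R} :=
  \sum_(q < k.+1) (a_coefs k b)`_q *: 'X^q.

Definition tildeC (R : realType) (k : nat) (b : R) : {poly R} :=
  \sum_(q < k) (c_coefs k b)`_q *: 'X^q.

Definition tildeD (R : realType) (k : nat) (b : R) : {poly R} :=
  \sum_(q < k) (d_coefs k b)`_q *: 'X^q.

Definition ceval (R : realType) (p : {poly R}) (z : R[i]) : R[i] :=
  (map_poly (real_complex R) p).[z].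

(* Main.v *)
(* The substitution q = z / (z - 1) maps |z| > 1 onto the half-plane
   Re q > 1/2 and turns A_k(z), z C_k(z) and D_k(z) into simple polynomials in q
   times a power of z - 1 (times a positive constant for D_k).

   Positivity: Re (N / M) has the sign of Re (N conj(M)). Put q = u + 1/2 + i y
   and b = t + 1 (b = t + 2 for D_4), so that t >= 0 and u > 0. Then
   Re (N conj(M)) is a polynomial in t, u and y^2 with nonnegative coefficients,
   up to explicit nonnegative terms built from squares for A_4, D_3 and D_4.

   Coprimality: as C_k(1) = 1, a common complex root is different from 1, hence
   gives a common root in q, which a Bezout identity over the reals excludes. *)
Require Import Defs.
From mathcomp Require Import all_boot all_order all_algebra.
From mathcomp Require Import complex reals.
From mathcomp Require Import ring lra.

Set Implicit Arguments.
Unset Strict Implicit.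
Unset Printing Implicit Defensive.

Import Order.TTheory GRing.Theory Num.Theory.
Local Open Scope ring_scope.
Local Open Scope complex_scope.

(** * Complex evaluation, and criteria for coprimality and for positive real part *)

Lemma ceval_sum (R : realType) (n : nat) (s : seq R) (z : R[i]) :
  ceval (\sum_(q < n) s`_q *: 'X^q) z = \sum_(q < n) (s`_q)%:C * z ^+ q.
Proof.
rewrite /ceval raddf_sum horner_sum; apply: eq_bigr => i _.
by rewrite /= map_polyZ map_polyXn hornerZ hornerXn.
Qed.

(** Coprimality is unchanged by passing from [R] to the algebraically closed field [R[i]], where it
    amounts to having no common root. *)
Lemma coprimep_ceval (R : realType) (p q : {poly R}) :
  (forall z : R[i], ceval p z = 0 -> ceval q z = 0 -> False) -> coprimep p q.
Proof.
move=> pq; rewrite -(coprimep_map (real_complex R)).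
apply/Pdiv.ClosedField.coprimepP => z /rootP pz; apply/eqP => qz.
exact: pq pz qz.
Qed.

(** The expression in the hypothesis is Re (u conj(v)) = |v|^2 Re (u / v); its positivity already
    forces [v] to be nonzero. *)
Lemma Re_div_gt0 (R : realType) (u v : R[i]) :
  0 < complex.Re u * complex.Re v + complex.Im u * complex.Im v ->
  0 < complex.Re (u / v).
Proof.
case: u v => [u1 u2] [v1 v2] /= uv.
have v_gt0 : 0 < v1 ^+ 2 + v2 ^+ 2.
  rewrite lt_neqAle addr_ge0 ?sqr_ge0 // andbT.
  apply: contraTneq uv => /esym/eqP.
  rewrite paddr_eq0 ?sqr_ge0 // !sqrf_eq0 => /andP[/eqP-> /eqP->].
  by rewrite !mulr0 addr0 ltxx.
rewrite [ltRHS](_ : _ = (u1 * v1 + u2 * v2) / (v1 ^+ 2 + v2 ^+ 2)) ?divr_gt0 //.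
by field; rewrite gt_eqF.
Qed.

(** * The substitution q = z / (z - 1) *)

Lemma normc_gt1_neq1 (R : realType) (z : R[i]) : 1 < `|z| -> z != 1.
Proof. by apply: contraTneq => ->; rewrite normr1 ltxx. Qed.

(** The difference of the two sides is (|z|^2 - 1) / (2 |z - 1|^2). *)
Lemma Re_mobius_gt (R : realType) (z : R[i]) :
  1 < `|z| -> 1 / 2 < complex.Re (z / (z - 1)).
Proof.
move=> z1; have := normc_gt1_neq1 z1; rewrite -subr_eq0.
case: z z1 => x y; rewrite normc_def ltcR /= => z1 zN1.
have {}z1 : 1 < x ^+ 2 + y ^+ 2.
  by rewrite ltNge; apply/negP => /ler_wsqrtr; rewrite sqrtr1 leNgt z1.
have d_gt0 : 0 < (x - 1) ^+ 2 + y ^+ 2.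
  rewrite lt_neqAle addr_ge0 ?sqr_ge0 // andbT.
  apply: contraNneq zN1 => /esym/eqP.
  rewrite paddr_eq0 ?sqr_ge0 // !sqrf_eq0 => /andP[/eqP x1 /eqP->].
  by rewrite eq_complex /= x1 oppr0 addr0 !eqxx.
rewrite [ltRHS](_ : _ = (x ^+ 2 + y ^+ 2 - x) / ((x - 1) ^+ 2 + y ^+ 2)).
  by rewrite ltr_pdivlMr //; lra.
by field; rewrite ?oppr0 ?addr0 gt_eqF.
Qed.

(** Put x = 1 / q, so that 1 - x = 1 / z. From the top power of [q] down, the coefficients of the
    image of A_k are those of x, ..., x^k in the series - (1 - x)^(1 - b) log (1 - x). *)
Definition hatA2 (R : realType) (b : R) (q : R[i]) : R[i] := q + (b - 1 / 2)%:C.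

Definition hatA3 (R : realType) (b : R) (q : R[i]) : R[i] :=
  q * (q + (b - 1 / 2)%:C) + (b ^+ 2 / 2 - 1 / 6)%:C.

Definition hatA4 (R : realType) (b : R) (q : R[i]) : R[i] :=
  q * (q * (q + (b - 1 / 2)%:C) + (b ^+ 2 / 2 - 1 / 6)%:C)
  + ((2 * b ^+ 3 + 3 * b ^+ 2 - b - 1) / 12)%:C.

(** Here the coefficients are those of 1, ..., x^(k - 1) in the series (1 - x)^(- b), with x = 1 /
    q. *)
Definition hatC2 (R : realType) (b : R) (q : R[i]) : R[i] := q + b%:C.

Definition hatC3 (R : realType) (b : R) (q : R[i]) : R[i] :=
  q * (q + b%:C) + (b * (b + 1) / 2)%:C.

Definition hatC4 (R : realType) (b : R) (q : R[i]) : R[i] :=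
  q * (q * (q + b%:C) + (b * (b + 1) / 2)%:C) + (b * (b + 1) * (b + 2) / 6)%:C.

(* [hatD3] and [hatD4] are the images of D_3 and D_4 scaled by b + 1 and b + 3;
   the image of D_2 scaled by b is q itself. *)
Definition hatD3 (R : realType) (b : R) (q : R[i]) : R[i] :=
  q * (2 * q + (b - 1)%:C).

Definition hatD4 (R : realType) (b : R) (q : R[i]) : R[i] :=
  q * (q * (4 * q + (3 * (b - 1))%:C) + (b * (b - 1))%:C)
  + (b * (b ^+ 2 - 1) / 6)%:C.

Ltac expand_ceval := rewrite ceval_sum !big_ord_recr big_ord0 /=.

Section Evaluation.
Variables (R : realType) (b : R) (z : R[i]).
Hypothesis z_neq1 : z - 1 != 0.
Let q := z / (z - 1).

(** The exponent of [z - 1] is k for A_k and k - 1 for C_k and D_k. As z = q (z - 1), these powers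
    cancel in both quotients. *)
Lemma ceval_tildeA2 : ceval (tildeA 2 b) z = hatA2 b q * (z - 1) ^+ 2.
Proof. by expand_ceval; rewrite /hatA2 /q; field. Qed.

Lemma ceval_tildeA3 : ceval (tildeA 3 b) z = hatA3 b q * (z - 1) ^+ 3.
Proof. by expand_ceval; rewrite /hatA3 /q; field. Qed.

Lemma ceval_tildeA4 : ceval (tildeA 4 b) z = hatA4 b q * (z - 1) ^+ 4.
Proof. by expand_ceval; rewrite /hatA4 /q; field. Qed.

(** The exponent 1 is kept explicit so that [zM] and [cancel] below match every k alike. *)
Lemma ceval_tildeC2 : ceval (tildeC 2 b) z = hatC2 b q * (z - 1) ^+ 1.
Proof. by expand_ceval; rewrite /hatC2 /q; field. Qed.

Lemma ceval_tildeC3 : ceval (tildeC 3 b) z = hatC3 b q * (z - 1) ^+ 2.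
Proof. by expand_ceval; rewrite /hatC3 /q; field. Qed.

Lemma ceval_tildeC4 : ceval (tildeC 4 b) z = hatC4 b q * (z - 1) ^+ 3.
Proof. by expand_ceval; rewrite /hatC4 /q; field. Qed.

Lemma ceval_tildeD2 : b != 0 ->
  ceval (tildeD 2 b) z = b^-1%:C * q * (z - 1) ^+ 1.
Proof.
move=> b_neq0; expand_ceval; rewrite /q; field.
by rewrite z_neq1 fmorph_eq0.
Qed.

Lemma ceval_tildeD3 : b + 1 != 0 ->
  ceval (tildeD 3 b) z = (b + 1)^-1%:C * hatD3 b q * (z - 1) ^+ 2.
Proof.
move=> b1_neq0; expand_ceval; rewrite /hatD3 /q; field.
by rewrite z_neq1 -(rmorph1 (real_complex R)) -rmorphD fmorph_eq0.
Qed.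

Lemma ceval_tildeD4 : b + 3 != 0 ->
  ceval (tildeD 4 b) z = (b + 3)^-1%:C * hatD4 b q * (z - 1) ^+ 3.
Proof.
move=> b3_neq0; expand_ceval; rewrite /hatD4 /q; field.
by rewrite z_neq1 -(rmorph_nat (real_complex R)) -rmorphD fmorph_eq0.
Qed.

End Evaluation.

(** * Positivity on the half-plane Re q > 1/2 *)

Ltac nonneg :=
  match goal with
  | |- is_true (0 <= _ + _) => apply: addr_ge0; nonneg
  | |- is_true (0 <= _ ^+ 2) => exact: sqr_ge0
  | |- is_true (0 <= _ ^+ _) =>
      solve [exact: exprn_even_ge0 | apply: exprn_ge0; nonneg]
  | |- is_true (0 <= _ * _) => apply: mulr_ge0; nonneg
  | |- is_true (0 <= _^-1) => rewrite invr_ge0; nonneg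
  | |- is_true (0 <= _%:R) => exact: ler0n
  | |- _ => solve [assumption | exact: ltW | exact: ler01]
  end.

(** Strictness comes from the last summand alone, so every expansion ends with a positive constant.
    The sign of [y] is unknown, but it enters only through even powers. *)
Ltac positive := apply: ltr_wpDl; [nonneg | lra].

Lemma half_plane_ind (R : realType) (s : R) (P : R -> R[i] -> Prop) :
  (forall t u y, 0 <= t -> 0 < u -> P (t + s) (Complex (u + 1 / 2) y)) ->
  forall b q, s <= b -> 1 / 2 < complex.Re q -> P b q.
Proof.
move=> Psu b [x y] b_ge x_gt; rewrite -(subrK s b) -(subrK (1 / 2) x).
by apply: Psu; rewrite ?subr_ge0 ?subr_gt0.
Qed.

Lemma Re_hatA2_gt0 (R : realType) (b : R) (q : R[i]) :
  1 <= b -> 1 / 2 < complex.Re q ->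
  0 < complex.Re (hatA2 b q / (q * hatC2 b q)).
Proof.
move: b q; apply: half_plane_ind => t u y t_ge0 u_gt0.
apply: Re_div_gt0; rewrite /hatA2 /hatC2.
rewrite [ltRHS](_ : _ =
    u ^+ 3 + (2 * t + 3) * u ^+ 2 + u * y ^+ 2
    + (t ^+ 2 + 7 / 2 * t + 11 / 4) * u + y ^+ 2 + 1 / 2 * t ^+ 2 + 5 / 4 * t
    + 3 / 4);
  last by rewrite /=; field.
by positive.
Qed.

Lemma Re_hatA3_gt0 (R : realType) (b : R) (q : R[i]) :
  1 <= b -> 1 / 2 < complex.Re q ->
  0 < complex.Re (hatA3 b q / (q * hatC3 b q)).
Proof.
move: b q; apply: half_plane_ind => t u y t_ge0 u_gt0.
apply: Re_div_gt0; rewrite /hatA3 /hatC3.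
rewrite [ltRHS](_ : _ =
    u ^+ 5 + (2 * t + 4) * u ^+ 4 + 2 * u ^+ 3 * y ^+ 2
    + (2 * t ^+ 2 + 8 * t + 22 / 3) * u ^+ 3 + (2 * t + 5) * u ^+ 2 * y ^+ 2
    + (t ^+ 3 + 25 / 4 * t ^+ 2 + 145 / 12 * t + 85 / 12) * u ^+ 2 + u * y ^+ 4
    + (2 * t + 4) * u * y ^+ 2
    + (1 / 4 * t ^+ 4 + 9 / 4 * t ^+ 3 + 83 / 12 * t ^+ 2 + 103 / 12 * t
        + 173 / 48) * u + y ^+ 4
    + (1 / 4 * t ^+ 2 + 11 / 12 * t + 7 / 6) * y ^+ 2 + 1 / 8 * t ^+ 4
    + 7 / 8 * t ^+ 3 + 103 / 48 * t ^+ 2 + 103 / 48 * t + 35 / 48);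
  last by rewrite /=; field.
by positive.
Qed.

Lemma Re_hatA4_gt0 (R : realType) (b : R) (q : R[i]) :
  1 <= b -> 1 / 2 < complex.Re q ->
  0 < complex.Re (hatA4 b q / (q * hatC4 b q)).
Proof.
move: b q; apply: half_plane_ind => t u y t_ge0 u_gt0.
apply: Re_div_gt0; rewrite /hatA4 /hatC4.
(* The coefficient of u is a cubic in Y = y^2 with a negative linear term, which
   (Y - m)^2 (Y + 2m) = Y^3 - 3 m^2 Y + 2 m^3 absorbs for
   m = b (2b + 1) / 12. *)
rewrite [ltRHS](_ : _ =
    u * (y ^+ 2 - (t + 1) * (2 * t + 3) / 12) ^+ 2
      * (y ^+ 2 + (t + 1) * (2 * t + 3) / 6)
    + u ^+ 7 + (2 * t + 5) * u ^+ 6 + 3 * u ^+ 5 * y ^+ 2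
    + (2 * t ^+ 2 + 10 * t + 139 / 12) * u ^+ 5
    + (4 * t + 11) * u ^+ 4 * y ^+ 2
    + (4 / 3 * t ^+ 3 + 10 * t ^+ 2 + 70 / 3 * t + 50 / 3) * u ^+ 4
    + 3 * u ^+ 3 * y ^+ 4 + (2 * t ^+ 2 + 12 * t + 101 / 6) * u ^+ 3 * y ^+ 2
    + (7 / 12 * t ^+ 4 + 71 / 12 * t ^+ 3 + 127 / 6 * t ^+ 2 + 125 / 4 * t
        + 757 / 48) * u ^+ 3 + (2 * t + 7) * u ^+ 2 * y ^+ 4
    + (2 * t ^+ 2 + 10 * t + 12) * u ^+ 2 * y ^+ 2
    + (1 / 6 * t ^+ 5 + 13 / 6 * t ^+ 4 + 763 / 72 * t ^+ 3
        + 145 / 6 * t ^+ 2 + 1829 / 72 * t + 155 / 16) * u ^+ 2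
    + (2 * t + 21 / 4) * u * y ^+ 4
    + (37 / 48 * t ^+ 2 + 85 / 24 * t + 101 / 24) * u * y ^+ 2
    + (1 / 54 * t ^+ 6 + 7 / 18 * t ^+ 5 + 49 / 18 * t ^+ 4
        + 7753 / 864 * t ^+ 3 + 4327 / 288 * t ^+ 2 + 3485 / 288 * t
        + 695 / 192) * u + y ^+ 6 + 2 / 3 * y ^+ 4
    + (1 / 72 * t ^+ 3 + 1 / 6 * t ^+ 2 + 19 / 36 * t + 29 / 48) * y ^+ 2
    + 1 / 72 * t ^+ 6 + 3 / 16 * t ^+ 5 + t ^+ 4 + 769 / 288 * t ^+ 3
    + 535 / 144 * t ^+ 2 + 361 / 144 * t + 5 / 8);
  last by rewrite /=; field.
by positive.
Qed.

Lemma Re_hatD2_gt0 (R : realType) (b : R) (q : R[i]) :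
  1 <= b -> 1 / 2 < complex.Re q ->
  0 < complex.Re (q / hatC2 b q).
Proof.
move: b q; apply: half_plane_ind => t u y t_ge0 u_gt0.
apply: Re_div_gt0; rewrite /hatC2.
rewrite [ltRHS](_ : _ =
    u ^+ 2 + (t + 2) * u + y ^+ 2 + 1 / 2 * t + 3 / 4);
  last by rewrite /=; field.
by positive.
Qed.

Lemma Re_hatD3_gt0 (R : realType) (b : R) (q : R[i]) :
  1 <= b -> 1 / 2 < complex.Re q ->
  0 < complex.Re (hatD3 b q / hatC3 b q).
Proof.
move: b q; apply: half_plane_ind => t u y t_ge0 u_gt0.
apply: Re_div_gt0; rewrite /hatD3 /hatC3.
(* The only negative coefficient of the expanded form is that of [y ^+ 2], namely - t / 2;
   completing the square with 2 y^4 removes it. *)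
rewrite [ltRHS](_ : _ =
    2 * (y ^+ 2 - t / 8) ^+ 2 + 2 * u ^+ 4 + (3 * t + 6) * u ^+ 3
    + 4 * u ^+ 2 * y ^+ 2 + (2 * t ^+ 2 + 17 / 2 * t + 8) * u ^+ 2
    + (3 * t + 6) * u * y ^+ 2
    + (1 / 2 * t ^+ 3 + 7 / 2 * t ^+ 2 + 29 / 4 * t + 9 / 2) * u
    + 1 / 4 * t ^+ 3 + 39 / 32 * t ^+ 2 + 15 / 8 * t + 7 / 8);
  last by rewrite /=; field.
by positive.
Qed.

Lemma Re_hatD4_gt0 (R : realType) (b : R) (q : R[i]) :
  2 <= b -> 1 / 2 < complex.Re q ->
  0 < complex.Re (hatD4 b q / hatC4 b q).
Proof.
move: b q; apply: half_plane_ind => t u y t_ge0 u_gt0.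
apply: Re_div_gt0; rewrite /hatD4 /hatC4.
(* At u = 0 the form is a cubic in Y = y^2. The first term below matches its
   coefficients of Y^3 and Y^2, and its double root b (3b + 10) / 24 is chosen
   so that the remaining linear function of Y is positive for b >= 2. *)
rewrite [ltRHS](_ : _ =
    (y ^+ 2 - (t + 2) * (3 * t + 16) / 24) ^+ 2
      * (4 * y ^+ 2 + (6 * t ^+ 2 + 41 * t + 67) / 6)
    (* The coefficient of u is a quadratic in Y with a negative linear term; the square with double
       root b / 12 absorbs it and leaves (b + 3)^2 Y / 6. *)
    + (7 * t + 23) * u * (y ^+ 2 - (t + 2) / 12) ^+ 2 + 4 * u ^+ 6
    + (7 * t + 23) * u ^+ 5 + 12 * u ^+ 4 * y ^+ 2
    + (6 * t ^+ 2 + 79 / 2 * t + 125 / 2) * u ^+ 4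
    + (14 * t + 46) * u ^+ 3 * y ^+ 2
    + (10 / 3 * t ^+ 3 + 33 * t ^+ 2 + 631 / 6 * t + 215 / 2) * u ^+ 3
    + 12 * u ^+ 2 * y ^+ 4 + (6 * t ^+ 2 + 39 * t + 63) * u ^+ 2 * y ^+ 2
    + (7 / 6 * t ^+ 4 + 46 / 3 * t ^+ 3 + 220 / 3 * t ^+ 2 + 1811 / 12 * t
        + 225 / 2) * u ^+ 2
    + (1 / 6 * t ^+ 2 + 5 / 3 * t + 25 / 6) * u * y ^+ 2
    + (1 / 4 * t ^+ 5 + 49 / 12 * t ^+ 4 + 3725 / 144 * t ^+ 3
        + 1269 / 16 * t ^+ 2 + 1879 / 16 * t + 9655 / 144) * u
    + (1 / 48 * t ^+ 4 + 7 / 24 * t ^+ 3 + 35 / 24 * t ^+ 2 + 3 * t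
        + 13 / 6) * y ^+ 2 + 7 / 576 * t ^+ 6 + 79 / 384 * t ^+ 5
    + 1571 / 1152 * t ^+ 4 + 479 / 108 * t ^+ 3 + 2047 / 288 * t ^+ 2
    + 1303 / 288 * t + 47 / 864);
  last by rewrite /=; field.
by positive.
Qed.

(** * Bezout identities in q *)

Lemma realC_gt0_neq0 (R : realType) (c : R) : 0 < c -> c%:C <> 0.
Proof. by move=> c_gt0 /eqP; rewrite fmorph_eq0 gt_eqF. Qed.

(** The factor [q] is excluded by the positive constant term of [hatA2], the factor [hatC2] by a
    Bezout identity. The cases k = 3, 4 follow the same pattern. *)
Lemma hatA2_coprime (R : realType) (b : R) (q : R[i]) : 1 <= b ->
  hatA2 b q = 0 -> q * hatC2 b q = 0 -> False.
Proof.
move=> b_ge1 Aq0 /eqP; rewrite mulf_eq0 => /orP[] /eqP; last first.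
  move=> Cq0; apply: (@realC_gt0_neq0 R (1 / 2)); first by lra.
  rewrite (_ : _%:C = hatC2 b q - hatA2 b q).
    by rewrite Aq0 Cq0 subrr.
  by rewrite /hatA2 /hatC2; field.
move=> q0; move: Aq0; rewrite q0 /hatA2 add0r.
by apply: realC_gt0_neq0; lra.
Qed.

Lemma hatA3_coprime (R : realType) (b : R) (q : R[i]) : 1 <= b ->
  hatA3 b q = 0 -> q * hatC3 b q = 0 -> False.
Proof.
move=> b_ge1 Aq0 /eqP; rewrite mulf_eq0 => /orP[] /eqP; last first.
  move=> Cq0.
  (* This is 72 times the resultant of [hatA3] and [hatC3] with respect to q. *)
  apply: (@realC_gt0_neq0 R (9 * b ^+ 2 + 15 * b + 2)); first by nra.
  rewrite (_ : _%:C = (36 * q - 12) * hatA3 b q + (30 - 36 * q) * hatC3 b q).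
    by rewrite Aq0 Cq0 !mulr0 addr0.
  by rewrite /hatA3 /hatC3; field.
move=> q0; move: Aq0; rewrite q0 /hatA3 mul0r add0r.
by apply: realC_gt0_neq0; nra.
Qed.

Lemma hatA4_coprime (R : realType) (b : R) (q : R[i]) : 1 <= b ->
  hatA4 b q = 0 -> q * hatC4 b q = 0 -> False.
Proof.
move=> b_ge1 Aq0 /eqP; rewrite mulf_eq0 => /orP[] /eqP; last first.
  move=> Cq0; have b_gt0 : 0 < b by lra.
  apply: (@realC_gt0_neq0 R (18 * b ^+ 6 + 144 * b ^+ 5 + 426 * b ^+ 4
    + 566 * b ^+ 3 + 321 * b ^+ 2 + 55 * b + 3)); first by positive.
  (* Both Bezout cofactors depend on [b] only through [s], in which they are affine. *)
  have [s def_s] : {s : R | s = b * (b + 2) ^+ 2} by exists (b * (b + 2) ^+ 2).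
  rewrite (_ : _%:C =
      (72 * q ^+ 2 + (216 * s + 72)%:C * q - (72 * s + 36)%:C) * hatA4 b q
    + ((180 * s + 84)%:C - 72 * q ^+ 2 - (216 * s + 36)%:C * q) * hatC4 b q).
    by rewrite Aq0 Cq0 !mulr0 addr0.
  by rewrite def_s /hatA4 /hatC4; field.
move=> q0; move: Aq0; rewrite q0 /hatA4 mul0r add0r.
by apply: realC_gt0_neq0; nra.
Qed.

Lemma hatD2_coprime (R : realType) (b : R) (q : R[i]) : 1 <= b ->
  q = 0 -> hatC2 b q = 0 -> False.
Proof.
by move=> b_ge1 ->; rewrite /hatC2 add0r; apply: realC_gt0_neq0; lra.
Qed.

(** Since hatD3 = 2 hatC3 - (b + 1) hatC2, a common root is also a root of [hatC2], while hatC3 - q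
    hatC2 = b (b + 1) / 2 is nonzero. The identity below eliminates [hatC2] from these two
    relations. *)
Lemma hatD3_coprime (R : realType) (b : R) (q : R[i]) : 1 <= b ->
  hatD3 b q = 0 -> hatC3 b q = 0 -> False.
Proof.
move=> b_ge1 Dq0 Cq0; apply: (@realC_gt0_neq0 R (b * (b + 1) ^+ 2)).
  by rewrite mulr_gt0 ?exprn_gt0 //; lra.
rewrite (_ : _%:C = 2 * q * hatD3 b q + ((2 * b + 2)%:C - 4 * q) * hatC3 b q).
  by rewrite Dq0 Cq0 !mulr0 addr0.
by rewrite /hatD3 /hatC3; field.
Qed.

(** The same elimination, from hatD4 = 4 hatC4 - (b + 3) hatC3 and hatC4 - q hatC3 = b (b + 1) (b +
    2) / 6. *)
Lemma hatD4_coprime (R : realType) (b : R) (q : R[i]) : 1 <= b ->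
  hatD4 b q = 0 -> hatC4 b q = 0 -> False.
Proof.
move=> b_ge1 Dq0 Cq0.
apply: (@realC_gt0_neq0 R (b * (b + 1) * (b + 2) * (b + 3))).
  by rewrite !mulr_gt0 //; lra.
rewrite (_ : _%:C = 6 * q * hatD4 b q + ((6 * b + 18)%:C - 24 * q) * hatC4 b q).
  by rewrite Dq0 Cq0 !mulr0 addr0.
by rewrite /hatD4 /hatC4; field.
Qed.

(** * Transfer from q back to z *)

Lemma ceval_tildeC_1 (R : realType) (k : nat) (b : R) :
  k \in [:: 2; 3; 4]%N -> ceval (tildeC k b) 1 = 1.
Proof.
by rewrite !inE => /or3P[] /eqP->; expand_ceval; field.
Qed.

Lemma ceval_XM (R : realType) (p : {poly R}) (z : R[i]) :
  ceval ('X * p) z = z * ceval p z.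
Proof. by rewrite /ceval rmorphM /= map_polyX hornerM hornerX. Qed.

Lemma coprimep_tildeA (R : realType) (k : nat) (b : R) : 1 <= b ->
  k \in [:: 2; 3; 4]%N -> coprimep (tildeA k b) ('X * tildeC k b).
Proof.
move=> b_ge1 hk; apply: coprimep_ceval => z; rewrite ceval_XM.
have [-> _ /eqP|] := eqVneq z 1.
  by rewrite ceval_tildeC_1 // mulr1 oner_eq0.
rewrite -subr_eq0 => z_neq1; set q := z / (z - 1).
have zM (u : R[i]) n : z * (u * (z - 1) ^+ n) = q * u * (z - 1) ^+ n.+1.
  by rewrite exprS /q; field.
have cancel (u : R[i]) n : u * (z - 1) ^+ n = 0 -> u = 0.
  by move/eqP; rewrite mulf_eq0 expf_eq0 (negbTE z_neq1) andbF orbF => /eqP.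
move: hk; rewrite !inE => /or3P[] /eqP->.
- rewrite ceval_tildeA2 // ceval_tildeC2 // zM.
  by move=> /cancel ? /cancel; apply: hatA2_coprime.
- rewrite ceval_tildeA3 // ceval_tildeC3 // zM.
  by move=> /cancel ? /cancel; apply: hatA3_coprime.
- rewrite ceval_tildeA4 // ceval_tildeC4 // zM.
  by move=> /cancel ? /cancel; apply: hatA4_coprime.
Qed.

Lemma coprimep_tildeD (R : realType) (k : nat) (b : R) : 1 <= b ->
  k \in [:: 2; 3; 4]%N -> coprimep (tildeD k b) (tildeC k b).
Proof.
move=> b_ge1 hk; apply: coprimep_ceval => z.
have [-> _ /eqP|] := eqVneq z 1.
  by rewrite ceval_tildeC_1 // oner_eq0.
rewrite -subr_eq0 => z_neq1; set q := z / (z - 1).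
have cancel (u : R[i]) n : u * (z - 1) ^+ n = 0 -> u = 0.
  by move/eqP; rewrite mulf_eq0 expf_eq0 (negbTE z_neq1) andbF orbF => /eqP.
have cancelR (c : R) (u : R[i]) n :
    c != 0 -> c^-1%:C * u * (z - 1) ^+ n = 0 -> u = 0.
  move=> c0 /cancel /eqP; rewrite mulf_eq0 fmorph_eq0 invr_eq0 (negbTE c0).
  by move/eqP.
have [b0 b1 b3] : [/\ b != 0, b + 1 != 0 & b + 3 != 0].
  by split; rewrite gt_eqF //; lra.
move: hk; rewrite !inE => /or3P[] /eqP->.
- rewrite ceval_tildeD2 // ceval_tildeC2 //.
  by move=> /(cancelR _ _ _ b0) ? /cancel; apply: hatD2_coprime.
- rewrite ceval_tildeD3 // ceval_tildeC3 //.
  by move=> /(cancelR _ _ _ b1) ? /cancel; apply: hatD3_coprime.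
- rewrite ceval_tildeD4 // ceval_tildeC4 //.
  by move=> /(cancelR _ _ _ b3) ? /cancel; apply: hatD4_coprime.
Qed.

Lemma mulf_divr (F : fieldType) (u v w : F) : w != 0 -> u * w / (v * w) = u / v.
Proof. by move=> w_neq0; rewrite -mulf_div divff // mulr1. Qed.

Lemma Re_realM (R : realType) (c : R) (u : R[i]) :
  complex.Re (c%:C * u) = c * complex.Re u.
Proof. by case: u => x y /=; rewrite mul0r subr0. Qed.

Lemma Re_tildeA_gt0 (R : realType) (k : nat) (b : R) (z : R[i]) : 1 <= b ->
  k \in [:: 2; 3; 4]%N -> 1 < `|z| ->
  0 < complex.Re (ceval (tildeA k b) z / (z * ceval (tildeC k b) z)).
Proof.
move=> b_ge1 hk z_gt1; have q_gt := Re_mobius_gt z_gt1.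
have := normc_gt1_neq1 z_gt1; rewrite -subr_eq0 => z_neq1.
have zM (u : R[i]) n :
    z * (u * (z - 1) ^+ n) = z / (z - 1) * u * (z - 1) ^+ n.+1.
  by rewrite exprS; field.
move: hk; rewrite !inE => /or3P[] /eqP->.
- rewrite ceval_tildeA2 // ceval_tildeC2 // zM mulf_divr ?expf_neq0 //.
  exact: Re_hatA2_gt0.
- rewrite ceval_tildeA3 // ceval_tildeC3 // zM mulf_divr ?expf_neq0 //.
  exact: Re_hatA3_gt0.
- rewrite ceval_tildeA4 // ceval_tildeC4 // zM mulf_divr ?expf_neq0 //.
  exact: Re_hatA4_gt0.
Qed.

Lemma Re_tildeD_gt0 (R : realType) (k : nat) (b : R) (z : R[i]) : 1 <= b ->
  k \in [:: 2; 3]%N -> 1 < `|z| ->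
  0 < complex.Re (ceval (tildeD k b) z / ceval (tildeC k b) z).
Proof.
move=> b_ge1 hk z_gt1; have q_gt := Re_mobius_gt z_gt1.
have := normc_gt1_neq1 z_gt1; rewrite -subr_eq0 => z_neq1.
have [b_gt0 b1_gt0] : 0 < b /\ 0 < b + 1 by split; lra.
have [b0 b1] : b != 0 /\ b + 1 != 0 by rewrite !gt_eqF.
move: hk; rewrite !inE => /orP[] /eqP->.
- rewrite ceval_tildeD2 // ceval_tildeC2 // mulf_divr ?expf_neq0 //.
  by rewrite -mulrA Re_realM mulr_gt0 ?invr_gt0 ?Re_hatD2_gt0.
- rewrite ceval_tildeD3 // ceval_tildeC3 // mulf_divr ?expf_neq0 //.
  by rewrite -mulrA Re_realM mulr_gt0 ?invr_gt0 ?Re_hatD3_gt0.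
Qed.

Lemma Re_tildeD4_gt0 (R : realType) (b : R) (z : R[i]) : 2 <= b -> 1 < `|z| ->
  0 < complex.Re (ceval (tildeD 4 b) z / ceval (tildeC 4 b) z).
Proof.
move=> b_ge2 z_gt1; have q_gt := Re_mobius_gt z_gt1.
have := normc_gt1_neq1 z_gt1; rewrite -subr_eq0 => z_neq1.
have b3_gt0 : 0 < b + 3 by lra.
have b3 : b + 3 != 0 by rewrite gt_eqF.
rewrite ceval_tildeD4 // ceval_tildeC4 // mulf_divr ?expf_neq0 //.
by rewrite -mulrA Re_realM mulr_gt0 ?invr_gt0 ?Re_hatD4_gt0.
Qed.

Unset Implicit Arguments.
Local Close Scope complex_scope.

(* In (ii)-(iv) a vanishing denominator would make the quotient 0, so the
   strict inequalities also assert that the denominators do not vanish. *)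
Theorem theorem1 (R : realType) (b : R) (hb : 1 <= b) :
  [/\ (forall k : nat, k \in [:: 2; 3; 4]%N ->
         coprimep (tildeA k b) ('X * tildeC k b)
         /\ coprimep (tildeD k b) (tildeC k b)),
      (forall k : nat, k \in [:: 2; 3; 4]%N ->
         forall z : R[i], 1 < `|z| ->
           0 < complex.Re (ceval (tildeA k b) z / (z * ceval (tildeC k b) z))),
      (forall k : nat, k \in [:: 2; 3]%N ->
         forall z : R[i], 1 < `|z| ->
           0 < complex.Re (ceval (tildeD k b) z / ceval (tildeC k b) z))
    & (2 <= b ->
         forall z : R[i], 1 < `|z| ->
           0 < complex.Re (ceval (tildeD 4 b) z / ceval (tildeC 4 b) z))].
Proof.
split=> [k hk|k hk z|k hk z|b_ge2 z].
- by split; [exact: coprimep_tildeA | exact: coprimep_tildeD].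
- exact: Re_tildeA_gt0.
- exact: Re_tildeD_gt0.
- exact: Re_tildeD4_gt0.
Qed.
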